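(* Let $B = \{b_1 < b_2 < \dots\}$ be an infinite sequence of integers with $b_1 \geq 11$, $b_2 = 3b_1 + 5$, $b_3 = 3b_2 + 2$, and $b_{n+1} = 3b_n + 4b_{n-1}$ for all $n \geq 3$. Then there exists a sequence of positive integers $A = \{a_1 < a_2 < \dots\}$ such that $P(A) = \mathbb{N} \setminus B$.
   Context: $\mathbb{N}$ denotes the set of all nonnegative integers. For a set $A = \{a_1 < a_2 < \dots\}$ of positive integers, $P(A) = \{\sum \varepsilon_i a_i : a_i \in A, \varepsilon_i \in \{0,1\}, \sum \varepsilon_i < \infty\}$ is the set of all finite subset sums of $A$; in particular $0 \in P(A)$ (empty sum). *)

(* Defs.v *)
From mathcomp Require Export all_boot all_order finmap.
From mathcomp Require Export boolp classical_sets.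
Set Implicit Arguments.
Unset Strict Implicit.
Unset Printing Implicit Defensive.
Local Open Scope classical_set_scope.
Local Open Scope nat_scope.

(* P(A): the choice of a finitely supported 0/1 sequence of coefficients is
   the choice of a finite subset F of A; F = fset0 gives 0 \in P(A). *)
Definition subset_sums (A : set nat) : set nat :=
  [set \sum_(x <- F) x | F in [set F : {fset nat} | [set` F] `<=` A]].

(* Main.v *)
Require Import Defs.
From mathcomp Require Import zify.
Local Open Scope classical_set_scope.
Local Open Scope nat_scope.

(** Write [s_n = b_n + b_(n-1)]; from some point on [s_(n+1) = 4 s_n]. The
    elements of [A] are chosen in stages, so that after stage [n] the subset
    sums are exactly the numbers of [[0, s_n]] other than the [b_j] and their
    mirror images [s_n - b_j], [j <= n]. Stage [n+1] adds the three elements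
    [s_n - b_(n-2)], [s_n] and [s_n + b_(n-2)]: all of them exceed [b_n], so no
    earlier [b_j] is hit; the new total is [4 s_n], whose mirror image of [b_n]
    is [b_(n+1)]; and since [b] grows by a factor larger than 3, the translates
    by the three elements cover each other's holes. The first stage consists
    of a set whose sums fill [[0, b_1 - 1]] (possible for [b_1 >= 11]) together
    with [b_1 + 1], [b_1 + 2], [b_1 + 3], [4 b_1 + 6] and [4 b_1 + 11]. *)

(** * Sums of sublists and of finite subsets *)

Fixpoint is_subsum (l : seq nat) (m : nat) : Prop :=
  if l is a :: l' then
    is_subsum l' m \/ exists2 m', is_subsum l' m' & m = a + m'
  else m = 0.

Lemma is_subsum_le_sumn l m : is_subsum l m -> m <= sumn l.
Proof.
by elim: l m => [|a l IH] m /=; [lia | case=> [/IH|[m' /IH]]; lia].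
Qed.

(** Exchange chosen and unchosen elements. This symmetry leaves only half of each range to be
    treated directly. *)
Lemma is_subsum_compl l m : is_subsum l m -> is_subsum l (sumn l - m).
Proof.
elim: l m => [|a l IH] m /=; first by move=> ->.
case=> [hm|[m' hm ->]].
- right; exists (sumn l - m); first exact: IH.
  by have := is_subsum_le_sumn _ _ hm; lia.
- left; have -> : a + sumn l - (a + m') = sumn l - m' by lia.
  exact: IH.
Qed.

Lemma is_subsum_uniq_sub l F : uniq F -> {subset F <= l} ->
  is_subsum l (\sum_(x <- F) x).
Proof.
elim: l F => [|a l IH] F uF sF /=.
  by case: F sF {uF} => [_|x F /(_ x)]; rewrite ?big_nil // mem_head => /(_ isT).
case: (boolP (a \in F)) => aF.
- right; exists (\sum_(x <- rem a F) x).
    apply: IH; first exact: rem_uniq.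
    move=> x; rewrite mem_rem_uniq // inE => /andP[/negbTE xa /sF].
    by rewrite inE xa.
  by rewrite (perm_big _ (perm_to_rem aF)) big_cons.
- left; apply: IH => // x xF; have := sF x xF; rewrite inE => /orP[/eqP xa|//].
  by move: aF; rewrite -xa xF.
Qed.

Lemma is_subsum_ex_uniq l m : uniq l -> is_subsum l m ->
  exists F : seq nat, [/\ uniq F, {subset F <= l} & \sum_(x <- F) x = m].
Proof.
elim: l m => [|a l IH] m /=.
  by move=> _ ->; exists [::]; rewrite big_nil.
move=> /andP[al ul] [/(IH _ ul)[F [uF sF <-]]|[m' /(IH _ ul)[F [uF sF <-]] ->]].
- by exists F; split=> // x /sF; rewrite inE orbC => ->.
- exists (a :: F); split=> /=.
  + by rewrite uF andbT; apply: contra al => /sF.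
  + by move=> x; rewrite !inE => /orP[->//|/sF ->]; rewrite orbT.
  + by rewrite big_cons.
Qed.

(** * Lists whose sums fill an initial interval *)

Definition fills (l : seq nat) (m : nat) : Prop :=
  [/\ sorted gtn l, all (ltn 0) l & forall k, is_subsum l k <-> k <= m].

Lemma fills_nil : fills [::] 0.
Proof. by split=> // k /=; lia. Qed.

Lemma fills_cons l m a : fills l m -> all (gtn a) l -> 0 < a <= m.+1 ->
  fills (a :: l) (a + m).
Proof.
move=> [sl pl hl] al am; split=> /=.
- by case: l sl al {pl hl} => //= x l -> /andP[-> _].
- by rewrite pl andbT; lia.
- move=> k; split=> [[/hl|[m' /hl]]|kam]; try lia.
  have [km|mk] := leqP k m; first by left; apply/hl.
  by right; exists (k - a); [apply/hl|]; lia.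
Qed.

(** Repeated halving from [m >= 20] ends in this range. The elements [1, 2, 3] or [1, 2, 4] or
    [1, 2, 3, 4] fill [[0, 6]], [[0, 7]] or [[0, 10]], and one larger element brings the total to
    [m]. *)
Lemma fills_small m : 10 <= m < 20 -> exists l, fills l m /\ all (gtn m) l.
Proof.
move=> hm.
have f1 := fills_cons _ _ 1 fills_nil isT isT.
have f21 := fills_cons _ _ 2 f1 isT isT.
have f321 := fills_cons _ _ 3 f21 isT isT.
have f421 := fills_cons _ _ 4 f21 isT isT.
have f4321 := fills_cons _ _ 4 f321 isT isT.
have [m13|m13] := ltnP m 13.
  exists [:: m - 6; 3; 2; 1]; split=> /=; last lia.
  by rewrite -[X in fills _ X](@subnK 6); [apply: fills_cons => //=|]; lia.
have [m16|m16] := ltnP m 16.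
  exists [:: m - 7; 4; 2; 1]; split=> /=; last lia.
  by rewrite -[X in fills _ X](@subnK 7); [apply: fills_cons => //=|]; lia.
exists [:: m - 10; 4; 3; 2; 1]; split=> /=; last lia.
by rewrite -[X in fills _ X](@subnK 10); [apply: fills_cons => //=|]; lia.
Qed.

(** Put [m - m./2] in front of a list for [m./2]: it is at most [m./2 + 1], so no gap opens, and at
    least [m./2], so the bound on the elements keeps the list strictly decreasing. *)
Lemma fills_exists m : 10 <= m -> exists l, fills l m /\ all (gtn m) l.
Proof.
elim/ltn_ind: m => m IH m10.
have [m20|m20] := ltnP m 20; first by apply: fills_small; lia.
have [l [fl al]] : exists l, fills l m./2 /\ all (gtn m./2) l by apply: IH; lia.
exists (m - m./2 :: l); split.
- rewrite -[X in fills _ X](@subnK m./2); last lia.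
  by apply: fills_cons => //; [apply: sub_all al => x /= |]; lia.
- by apply/andP; split; [|apply: sub_all al => x] => /=; lia.
Qed.

(** * Holes of a stage and the passage to the next one *)

Definition misses (b : nat -> nat) (n s : nat) (l : seq nat) : Prop :=
  forall m, is_subsum l m <->
    m <= s /\ forall j, j <= n -> m <> b j /\ m + b j <> s.

Section Stages.

Variable b : nat -> nat.
Hypothesis b_incr : forall m n : nat, m < n -> b m < b n.
Hypothesis b1_ge : 11 <= b 0.
Hypothesis b2E : b 1 = 3 * b 0 + 5.
Hypothesis b3E : b 2 = 3 * b 1 + 2.
Hypothesis bE : forall n : nat, 2 <= n -> b n.+1 = 3 * b n + 4 * b n.-1.

Lemma b_gt0 n : 0 < b n.
Proof. by case: n => [|n]; [|have := b_incr 0 n.+1 isT]; lia. Qed.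

Lemma b_le m n : m <= n -> b m <= b n.
Proof. by rewrite leq_eqVlt => /orP[/eqP ->//|/b_incr/ltnW]. Qed.

Lemma b_growS n : 3 * b n < b n.+1.
Proof.
case: n => [|[|n]]; [lia|lia|].
by have /= := bE n.+2 isT; have := b_gt0 n.+1; lia.
Qed.

Lemma b_grow m n : m < n -> 3 * b m < b n.
Proof.
by move=> mn; apply: leq_trans (b_growS m) _; apply: b_le.
Qed.

(** Two terms before [b i] sum to less than [2/3] of it; a summand with index [>= i] is already too
    large. *)
Lemma b_neq_add i j k : b i <> b j + b k.
Proof.
have [pj pk] := (b_gt0 j, b_gt0 k).
have [ij|ji] := leqP i j; first by have := b_le _ _ ij; lia.
have [ik|ki] := leqP i k; first by have := b_le _ _ ik; lia.
have := b_grow _ _ ji; have := b_grow _ _ ki; lia.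
Qed.

(** If neither index is [n.+2], the left side is too small; otherwise cancelling [b n.+2] leaves
    [b i + b n = b n.+1], which [b_neq_add] excludes. *)
Lemma b_add3_neq n i j : i <= n.+2 -> j <= n.+2 ->
  b i + b j + b n <> b n.+2 + b n.+1.
Proof.
wlog ij : i j / i <= j => [H|] hi hj.
  by case: (leqP i j) => [ij|/ltnW ij]; [|rewrite (addnC (b i))]; apply: H.
have [jn|nj] := leqP j n.+1.
  have := b_le _ _ jn; have := b_le _ _ (leq_trans ij jn).
  by have := b_growS n.+1; have := b_growS n; have := b_gt0 n; lia.
have -> : j = n.+2 by lia.
by have := b_neq_add n.+1 i n; lia.
Qed.

(** With indices from 0 this is s_(n+3), from where on the ratio is exactly 4. *)
Definition total (n : nat) : nat := b n.+2 + b n.+1.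

Lemma totalS n : total n.+1 = 4 * total n.
Proof. by rewrite /total bE //=; lia. Qed.

Definition extend (n : nat) (l : seq nat) : seq nat :=
  [:: total n + b n, total n, total n - b n & l].

Lemma misses_extend n l : sumn l = total n -> misses b n.+2 (total n) l ->
  sumn (extend n l) = total n.+1 /\ misses b n.+3 (total n.+1) (extend n l).
Proof.
move=> sl ml.
have sE : total n = b n.+2 + b n.+1 by [].
have b3 : b n.+3 + b n.+2 = 4 * total n by rewrite -totalS.
have g1 := b_growS n; have g2 := b_growS n.+1; have p := b_gt0 n.
have sumE : sumn (extend n l) = total n.+1 by rewrite totalS /= sl; lia.
split=> // m.
(* The lower half of the range; complements give the upper half. *)
have low k : k <= 2 * total n -> (forall j, j <= n.+2 -> k <> b j) ->
    is_subsum (extend n l) k.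
  move=> k2 kb; have [ks|sk] := leqP k (total n).
    have [hk|] := pselect (is_subsum l k); first by do 3!left.
    move=> nk; have [j [jn kj]] : exists j, j <= n.+2 /\ k + b j = total n.
      apply: contrapT => nj; apply: nk; apply/ml; split=> // j jn.
      by split=> [|E]; [exact: kb|apply: nj; exists j].
    (* [b n.+1] and [b n.+2] mirror each other in [total n], so for these [j] the number [k] would
       be a true hole. *)
    have bj : j <= n.
      rewrite leqNgt; apply/negP => nj.
      have [jE|jE] : j = n.+1 \/ j = n.+2 by lia.
      - by apply: (kb n.+2) => //; move: kj; rewrite jE; lia.
      - by apply: (kb n.+1) => //; move: kj; rewrite jE; lia.
    (* [total n - b j = (total n - b n) + (b n - b j)]. *)
    do 2!left; right; exists (b n - b j); last by have := b_le _ _ bj; lia.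
    apply/ml; split=> [|i hi]; first lia.
    have := b_neq_add n i j; have := b_gt0 i; have := b_gt0 j.
    by have := b_le _ _ bj; have := b_le _ _ hi; lia.
  have [hk|nk] := pselect (is_subsum l (k - total n)).
    by left; right; exists (k - total n); [left|]; [|lia].
  (* Holes of the translate by [total n] are reached from [total n - b n] with remainder
     [b j + b n]. *)
  have shift j : j <= n.+2 -> k = total n + b j -> is_subsum (extend n l) k.
    move=> jn kE; do 2!left; right; exists (b j + b n); last lia.
    apply/ml; split=> [|i hi].
      by have := b_le _ _ jn; lia.
    have := b_neq_add i j n; have := b_add3_neq n i j hi jn; lia.
  have [[j [jn kj]]|nj] := pselect (exists j, j <= n.+2 /\ k = total n + b j).
    exact: shift jn kj.
  have [j [jn kj]] : exists j, j <= n.+2 /\ k + b j = 2 * total n.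
    apply: contrapT => nj'; apply: nk; apply/ml; split=> [|j jn]; first lia.
    by split=> E; [apply: nj|apply: nj']; exists j; split=> //; lia.
  have bj : j <= n.
    rewrite leqNgt; apply/negP => jn'; apply: nj.
    have [jE|jE] : j = n.+1 \/ j = n.+2 by lia.
    - by exists n.+2; split=> //; move: kj; rewrite jE; lia.
    - by exists n.+1; split=> //; move: kj; rewrite jE; lia.
  have bjn := b_le _ _ bj.
  (* The mirrored holes are reached from [total n + b n] with remainder [total n - b j - b n]. *)
  right; exists (k - total n - b n); last lia.
  do 2!left; apply/ml; split=> [|i hi]; first lia.
  by have := b_neq_add i j n; have := b_add3_neq n i j hi jn; lia.
(* The three new elements all exceed [b n.+2]. *)
have avoid j : j <= n.+2 -> ~ is_subsum (extend n l) (b j).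
  move=> jn; have := b_le _ _ jn => bj /=.
  case=> [[[/ml[_ /(_ j jn)]|[? _]]|[? _]]|[? _]]; lia.
split=> [hm|[ms hm]].
- have ms := is_subsum_le_sumn _ _ hm; rewrite sumE in ms.
  have hc := is_subsum_compl _ _ hm; rewrite sumE in hc.
  (* The new hole [b n.+3] is the mirror image of [b n.+2] in [total n.+1]. *)
  split=> // j; rewrite leq_eqVlt => /orP[/eqP ->|jn]; split=> E.
  + apply: (avoid n.+2) => //.
    by have -> : b n.+2 = total n.+1 - m by rewrite totalS; lia.
  + apply: (avoid n.+2) => //.
    by have -> : b n.+2 = m by move: E; rewrite totalS; lia.
  + by apply: (avoid j) => //; rewrite -E.
  + by apply: (avoid j) => //; have -> : b j = total n.+1 - m by lia.
- have [m2|m2] := leqP m (2 * total n).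
    by apply: low => // j jn; have [] := hm j (leqW jn).
  have -> : m = sumn (extend n l) - (total n.+1 - m) by lia.
  apply/is_subsum_compl/low; first by rewrite totalS; lia.
  by move=> j jn; have [] := hm j (leqW jn); lia.
Qed.

(** * The first stage and the iteration *)

Definition first_stage (l : seq nat) : seq nat :=
  [:: 4 * b 0 + 11, 4 * b 0 + 6, b 0 + 3, b 0 + 2, b 0 + 1 & l].

Lemma misses_first_stage l : fills l (b 0 - 1) ->
  sumn (first_stage l) = total 0 /\ misses b 2 (total 0) (first_stage l).
Proof.
move=> [_ _ hl]; have hle k : is_subsum l k -> k <= b 0 - 1 by move/hl.
have lh k : k < b 0 -> is_subsum l k by move=> kb; apply/hl; lia.
have sl : sumn l = b 0 - 1.
  apply/eqP; rewrite eqn_leq is_subsum_le_sumn ?andbT; last by apply/hl.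
  by apply/hle; rewrite -[X in is_subsum _ X]subn0; apply/is_subsum_compl/lh; lia.
rewrite /total; split; first by rewrite /= sl; lia.
set l1 := b 0 + 1 :: l; set l3 := [:: b 0 + 3, b 0 + 2 & l1].
have h1 k : k <= 2 * b 0 -> k <> b 0 -> is_subsum l1 k.
  move=> k2 kb; have [kl|kl] := leqP k (b 0); first by left; apply: lh; lia.
  by right; exists (k - (b 0 + 1)); [apply: lh|]; lia.
(* These sums have total [4 * b 0 + 5], in which [3 * b 0 + 5] mirrors [b 0]. *)
have h3 k : k <= 4 * b 0 + 5 -> k <> b 0 -> k <> 3 * b 0 + 5 -> is_subsum l3 k.
  move=> k4 kb kb'; have [k1|k1] := leqP k (2 * b 0); first by do 2!left; apply: h1.
  have [k2|k2] := leqP (3 * b 0 + 4) k.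
    right; exists (k - (b 0 + 3)); last lia.
    by right; exists (k - (2 * b 0 + 5)); [apply: h1|]; lia.
  have [k3|k3] := leqP k (3 * b 0 + 2); last first.
    by right; exists (k - (b 0 + 3)); [left; apply: h1|]; lia.
  have [kE|kE] := eqVneq k (2 * b 0 + 2).
    by right; exists (k - (b 0 + 3)); [left; apply: h1|]; lia.
  by left; right; exists (k - (b 0 + 2)); [apply: h1|]; lia.
move=> m; split.
- move=> hm; have ms := is_subsum_le_sumn _ _ hm; rewrite /= sl in ms.
  split=> [|j j2]; first lia.
  have jE : b j = b 0 \/ b j = b 1 \/ b j = b 2.
    by case: j j2 => [|[|[|j]]] //; auto.
  (* Each choice among the five large elements confines the sum to [b 0] consecutive numbers, none
     of them a hole. *)
  move: hm; rewrite /first_stage /=.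
  by repeat match goal with
    | |- is_subsum l _ -> _ => move/hle => ?
    | |- _ \/ _ -> _ => case
    | |- (exists2 _, _ & _) -> _ => case=> ?
    | |- _ = _ -> _ => move=> ?
    end; lia.
- move=> [ms hm].
  have [n0 n0'] := hm 0 isT; have [n1 n1'] := hm 1 isT; have [n2 n2'] := hm 2 isT.
  have [m4|m4] := leqP m (4 * b 0 + 5); first by do 2!left; apply: h3; lia.
  have [m8|m8] := leqP (8 * b 0 + 17) m.
    right; exists (m - (4 * b 0 + 11)); last lia.
    by right; exists (m - (8 * b 0 + 17)); [apply: h3|]; lia.
  (* The translate by [4 * b 0 + 11] has holes [5 * b 0 + 11] and [7 * b 0 + 16]; the one by
     [4 * b 0 + 6] covers both. *)
  have [mE|mE] := pselect (m < 4 * b 0 + 11 \/ m = 5 * b 0 + 11 \/ m = 7 * b 0 + 16).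
    by left; right; exists (m - (4 * b 0 + 6)); [apply: h3|]; lia.
  by right; exists (m - (4 * b 0 + 11)); [left; apply: h3|]; lia.
Qed.

Fixpoint stage (l : seq nat) (n : nat) : seq nat :=
  if n is n'.+1 then extend n' (stage l n') else first_stage l.

Lemma stage_misses l n : fills l (b 0 - 1) ->
  sumn (stage l n) = total n /\ misses b n.+2 (total n) (stage l n).
Proof.
move=> fl; elim: n => [|n [IH1 IH2]]; first exact: misses_first_stage.
exact: misses_extend.
Qed.

(** The last bound carries the induction: [total n - b n] is the smallest element that the next
    stage adds. *)
Lemma stage_sorted l n : fills l (b 0 - 1) -> all (gtn (b 0 - 1)) l ->
  [/\ sorted gtn (stage l n), all (ltn 0) (stage l n)
    & all (gtn (total n - b n)) (stage l n)].
Proof.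
move=> [sl pl _] al; elim: n => [|n [IH1 IH2 IH3]].
  rewrite /total; split=> /=.
  - rewrite (path_sortedE (rev_trans ltn_trans)) sl andbT.
    have : all (gtn (b 0 + 1)) l by apply: sub_all al => x /=; lia.
    by rewrite /= => ->; lia.
  - by rewrite pl; lia.
  - have -> : all (gtn (b 2 + b 1 - b 0)) l by apply: sub_all al => x /=; lia.
    lia.
have g := b_gt0 n; have g1 := b_growS n; have g2 := b_growS n.+1.
have tE : total n = b n.+2 + b n.+1 by [].
have tS := totalS n.
split=> /=.
- rewrite (path_sortedE (rev_trans ltn_trans)) IH1 IH3; lia.
- by rewrite IH2; lia.
- have -> : all (gtn (total n.+1 - b n.+1)) (stage l n).
    by apply: sub_all IH3 => x /=; lia.
  lia.
Qed.

Lemma stage_size l n : n < size (stage l n).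
Proof. by elim: n => //= n IH; lia. Qed.

End Stages.

(** * Assembling the stages into one sequence *)

Lemma increasing_enum (L : nat -> seq nat) :
  (forall n, sorted ltn (L n)) -> (forall n, n < size (L n)) ->
  (forall n, prefix (L n) (L n.+1)) ->
  exists a : nat -> nat, (forall m n, m < n -> a m < a n) /\
    forall x, range a x <-> exists n, x \in L n.
Proof.
move=> sL zL pL.
have pfx m n : m <= n -> prefix (L m) (L n).
  move=> /subnK <-; elim: (n - m) => [|k IH]; first exact: prefix_refl.
  exact: prefix_trans IH (pL _).
have nthL m n i : m <= n -> i < size (L m) -> nth 0 (L n) i = nth 0 (L m) i.
  by move=> /pfx/prefixP[s ->] im; rewrite nth_cat im.
(* Diagonal choice: [L n] has more than [n] entries, so the default 0 never occurs, and later lists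
   keep the entry. *)
exists (fun n => nth 0 (L n) n); split=> [m n mn|x].
  rewrite -(nthL m n m) ?(ltnW mn) //.
  by apply: (sorted_ltn_nth ltn_trans) => //; rewrite inE //; apply: ltn_trans (zL n).
split=> [[n _ <-]|[n xn]]; first by exists n; apply: mem_nth.
exists (index x (L n)) => //; set i := index x (L n).
have iz : i < size (L n) by rewrite index_mem.
have [ni|ni] := leqP n i.
- by rewrite (nthL n i) // nth_index.
- by rewrite -(nthL i n) ?(ltnW ni) // nth_index.
Qed.

(* Sequences are indexed from 0: b n stands for b_{n+1}, a n for a_{n+1}. *)
Theorem theorem1p1 (b : nat -> nat)
  (b_incr : forall m n : nat, m < n -> b m < b n)
  (b1_ge : 11 <= b 0)
  (b2E : b 1 = 3 * b 0 + 5)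
  (b3E : b 2 = 3 * b 1 + 2)
  (bE : forall n : nat, 2 <= n -> b n.+1 = 3 * b n + 4 * b n.-1) :
  exists a : nat -> nat,
    [/\ forall n : nat, 0 < a n,
        forall m n : nat, m < n -> a m < a n
      & subset_sums (range a) = [set: nat] `\` range b].
Proof.
have [l [fl al]] : exists l, fills l (b 0 - 1) /\ all (gtn (b 0 - 1)) l.
  by apply: fills_exists; lia.
pose L := stage b l.
have mL n : misses b n.+2 (total b n) (L n).
  by apply: (stage_misses _ _ _ _ _ _ _ _ fl).2.
have srt n : [/\ sorted gtn (L n), all (ltn 0) (L n)
    & all (gtn (total b n - b n)) (L n)] by apply: stage_sorted.
have uL n : uniq (L n).
  have [+ _ _] := srt n; apply: sorted_uniq; first exact: rev_trans ltn_trans.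
  by move=> x /=; lia.
have bn n : n <= b n by elim: n => // n IH; have := b_incr n n.+1 (leqnn _); lia.
(* Stages grow at the front in decreasing order, so their reversals grow at the end. *)
have pL n : prefix (rev (L n)) (rev (L n.+1)).
  by rewrite /L /= !rev_cons -!cats1 -!catA prefix_prefix.
have subL m n : m <= n -> {subset L m <= L n}.
  move=> /subnK <-; elim: (n - m) => [//|k IH] x /IH.
  by rewrite addSn /L /= !inE => ->; rewrite !orbT.
have [a [a_incr ra]] : exists a : nat -> nat, (forall m n, m < n -> a m < a n) /\
    forall x, range a x <-> exists n, x \in rev (L n).
  apply: increasing_enum => // n; last by rewrite size_rev stage_size.
  by rewrite rev_sorted; have [] := srt n.
exists a; split=> // [n|].
  have [k] := (ra (a n)).1 (ex_intro2 _ _ n I erefl).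
  by rewrite mem_rev; have [_ /allP + _] := srt k; apply.
apply/seteqP; split=> [m [F /= Fa <-]|m /= [_ nb]].
(* A finite set lies in a single stage; a stage of index at least [j] then rules out the sum
   [b j]. *)
- have [K hK] : exists K, {subset (F : seq nat) <= L K}.
    have : forall x, x \in (F : seq nat) -> range a x by move=> x; apply: Fa.
    elim: (F : seq nat) => [|x s IH] hs; first by exists 0.
    have [|K hK] := IH; first by move=> y ys; apply: hs; rewrite inE ys orbT.
    have [k] := (ra x).1 (hs x (mem_head _ _)); rewrite mem_rev => xk.
    exists (maxn K k) => y; rewrite inE => /orP[/eqP ->|/hK].
    + by apply: subL xk; apply: leq_maxr.
    + by apply: subL; apply: leq_maxl.
  split=> // -[j _ bj].
  have hsum : is_subsum (L (maxn K j)) (\sum_(x <- F) x).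
    apply: is_subsum_uniq_sub; first exact: fset_uniq.
    by move=> x /hK; apply: subL; apply: leq_maxl.
  have [_ /(_ j)] := (mL _ _).1 hsum.
  by rewrite -bj => -[]; [lia|].
(* At stage [m.+1] every mirrored hole is at least [b m.+2 > m], so only membership in [B] could
   exclude [m]. *)
- have [F [uF sF <-]] : exists F : seq nat,
      [/\ uniq F, {subset F <= L m.+1} & \sum_(x <- F) x = m].
    apply: is_subsum_ex_uniq => //; apply/mL.
    have := bn m.+1; have := b_incr m.+1 m.+2 (leqnn _).
    have := b_incr m.+2 m.+3 (leqnn _); rewrite /total => h1 h2 h3.
    split=> [|j jm]; first lia.
    split=> [mb|]; first by apply: nb; exists j.
    have : b j <= b m.+3 by move: jm; rewrite leq_eqVlt => /orP[/eqP ->//|/b_incr/ltnW].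
    lia.
  exists [fset x in F]%fset => /=.
    by move=> x /=; rewrite inE => /sF xL; apply/ra; exists m.+1; rewrite mem_rev.
  by apply/perm_big/uniq_perm; rewrite ?fset_uniq // => x; rewrite inE.
Qed.
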